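(* For every fixed integer $k\ge 3$, $$\liminf_{n\to\infty} f_k(n)\ \ge\ \frac{2}{9}.$$
   Context: A $k$-graph is a $k$-uniform hypergraph. Given $k$-graphs $G$ and $H$, we say that $G$ is a unique subhypergraph of $H$, written $G\subseteq^* H$, if $H$ contains exactly one subhypergraph isomorphic to $G$ (that is, exactly one unlabelled copy of $G$; a subhypergraph consists of a subset of the vertices of $H$ together with a subset of the edges of $H$ contained in it). For an $n$-vertex $k$-graph $H$, $f_k(H)$ denotes the number of pairwise non-isomorphic $k$-graphs $G$ on at most $n$ vertices with $G\subseteq^* H$, divided by $2^{\binom nk}/n!$. Finally, $f_k(n)$ is the maximum of $f_k(H)$ over all $n$-vertex $k$-graphs $H$. *)

(* Defs.v *)
From HB Require Import structures.
From mathcomp Require Import all_boot all_order all_algebra.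
From mathcomp Require Import all_classical all_reals all_analysis.

Set Implicit Arguments.
Unset Strict Implicit.
Unset Printing Implicit Defensive.

Import Order.TTheory GRing.Theory Num.Theory.

(* The vertex set is an arbitrary subset of the ambient finite type T, so that *)
(* a k-graph, its subhypergraphs, and k-graphs with fewer vertices all have    *)
(* the same type. Isolated vertices matter: two k-graphs with the same edges   *)
(* but different vertex sets are different.                                    *)
Definition is_kgraph (k : nat) (T : finType)
    (G : {set T} * {set {set T}}) : bool :=
  [forall e in G.2, (e \subset G.1) && (#|e| == k)].

Record kgraph (k : nat) (T : finType) : Type := KGraph {
  kgraph_val : {set T} * {set {set T}};
  kgraph_prop : is_kgraph k kgraph_val
}.

HB.instance Definition _ (k : nat) (T : finType) :=
  [isSub for @kgraph_val k T].
HB.instance Definition _ (k : nat) (T : finType) :=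
  [Finite of kgraph k T by <:].

Definition vertices (k : nat) (T : finType) (G : kgraph k T) : {set T} :=
  (kgraph_val G).1.

Definition edges (k : nat) (T : finType) (G : kgraph k T) : {set {set T}} :=
  (kgraph_val G).2.

(* Only the restriction of f to the vertices of G is relevant. *)
Definition kgraph_iso (k : nat) (T : finType) (G H : kgraph k T) : bool :=
  [exists f : {ffun T -> T},
    [&& [forall x in vertices G, forall y in vertices G,
           (f x == f y) ==> (x == y)],
        f @: vertices G == vertices H &
        [set f @: (e : {set T}) | e in edges G] == edges H]].

Definition subhypergraph (k : nat) (T : finType) (G H : kgraph k T) : bool :=
  (vertices G \subset vertices H) && (edges G \subset edges H).

Definition unique_subhypergraph (k : nat) (T : finType)
    (G H : kgraph k T) : bool :=
  #|[set S : kgraph k T | subhypergraph S H && kgraph_iso G S]| == 1.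

(* Every k-graph on at most #|vertices H| vertices has an isomorphic copy with *)
(* vertices in T, because #|vertices H| <= #|T|; hence counting isomorphism    *)
(* classes inside T loses nothing.                                             *)
Definition num_unique (k : nat) (T : finType) (H : kgraph k T) : nat :=
  #|equivalence_partition (@kgraph_iso k T)
      [set G : kgraph k T | (#|vertices G| <= #|vertices H|)
                            && unique_subhypergraph G H]|.

Definition f_graph (R : realType) (k : nat) (T : finType)
    (H : kgraph k T) : R :=
  let n := #|vertices H| in
  ((num_unique H)%:R / (2 ^+ 'C(n, k) / (n`!)%:R))%R.

(* The values of f_graph are nonnegative, so the default value 0 of the        *)
(* iterated maximum is harmless.                                               *)
Definition f_max (R : realType) (k n : nat) : R :=
  \big[Num.max/0%R]_(H : kgraph k 'I_n | #|vertices H| == n) f_graph R H.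

Lemma kgraph_isoP (k : nat) (T : finType) (G H : kgraph k T) :
  reflect (exists f : T -> T,
    [/\ {in vertices G &, injective f}, f @: vertices G = vertices H &
        [set f @: (e : {set T}) | e in edges G] = edges H])
  (kgraph_iso G H).
Proof.
apply: (iffP existsP) => [[f /and3P[/forall_inP fI /eqP fV /eqP fE]]|].
  exists f; split=> // x y xG yG fxy.
  have /forall_inP fIx := fI x xG.
  by have := fIx y yG; rewrite fxy eqxx => /eqP.
move=> [f [fI fV fE]]; exists (finfun f); apply/and3P; split.
- apply/forall_inP => x xG; apply/forall_inP => y yG; apply/implyP; rewrite !ffunE => /eqP fxy.
  by apply/eqP; apply: fI.
- by rewrite -fV; apply/eqP; apply: eq_imset => x; rewrite ffunE.
- rewrite -fE; apply/eqP; apply: eq_imset => e.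
  by apply: eq_imset => x; rewrite ffunE.
Qed.

Lemma edge_sub (k : nat) (T : finType) (G : kgraph k T) (e : {set T}) :
  e \in edges G -> e \subset vertices G.
Proof.
by have /forall_inP/(_ e) GP := kgraph_prop G; move=> /GP/andP[].
Qed.

Lemma kgraph_iso_refl (k : nat) (T : finType) : reflexive (@kgraph_iso k T).
Proof.
move=> G; apply/kgraph_isoP; exists id; split=> //; first exact: imset_id.
rewrite -[RHS]imset_id; apply: eq_imset => e; exact: imset_id.
Qed.

Lemma kgraph_iso_sym (k : nat) (T : finType) : symmetric (@kgraph_iso k T).
Proof.
suff iso_sym (G H : kgraph k T) : kgraph_iso G H -> kgraph_iso H G.
  by move=> G H; apply/idP/idP; apply: iso_sym.
move=> /kgraph_isoP[f [fI fV fE]]; apply/kgraph_isoP.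
pose g y := odflt y [pick x in vertices G | f x == y].
have gK x : x \in vertices G -> g (f x) = x.
  move=> xG; rewrite /g; case: pickP => [z /andP[zG /eqP fzx]|/(_ x)] /=.
    exact: fI.
  by rewrite xG eqxx.
have gKs (A : {set T}) : A \subset vertices G -> g @: (f @: A) = A.
  move=> /fintype.subsetP AG; rewrite -imset_comp -[RHS]imset_id.
  by apply: eq_in_imset => x /AG /gK.
exists g; split.
- by move=> x y; rewrite -fV => /imsetP[a aG ->] /imsetP[b bG ->]; rewrite !gK // => ->.
- by rewrite -fV gKs.
- rewrite -fE -imset_comp -[RHS]imset_id; apply: eq_in_imset => e eG /=.
  exact/gKs/edge_sub.
Qed.

Lemma kgraph_iso_trans (k : nat) (T : finType) : transitive (@kgraph_iso k T).
Proof.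
move=> H G K /kgraph_isoP[f [fI fV fE]] /kgraph_isoP[g [gI gV gE]].
apply/kgraph_isoP; exists (g \o f); split.
- move=> x y xG yG /= gfxy; apply: fI => //; apply: gI => //.
  + by rewrite -fV imset_f.
  + by rewrite -fV imset_f.
- by rewrite imset_comp fV gV.
- rewrite -gE -fE -imset_comp; apply: eq_imset => e.
  by rewrite /= imset_comp.
Qed.

(* This makes the blocks of the partition in num_unique isomorphism classes. *)
Lemma kgraph_iso_equiv (k : nat) (T : finType) :
  equivalence_rel (@kgraph_iso k T).
Proof.
apply/equivalence_relP; split; first exact: kgraph_iso_refl.
move=> G H GH K; apply/idP/idP; last exact: kgraph_iso_trans.
by apply: kgraph_iso_trans; rewrite kgraph_iso_sym.
Qed.

(* Main.v *)
Require Import Defs.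
From mathcomp Require Import all_boot all_order all_algebra.
From mathcomp Require Import perm fingroup.
From mathcomp Require Import zify ring lra.

Set Implicit Arguments.
Unset Strict Implicit.
Unset Printing Implicit Defensive.

Import Order.TTheory GRing.Theory Num.Theory.

(** Let [N] be the number of k-subsets of an n-set.  Choose [m] with
    [3/2 n! < 2^m <= 3 n!] and let [H] have all k-sets as edges except those of
    a family [F] of size [m].  If [E] is a set of edges of [H] that no
    permutation other than the identity maps into [H], then the spanning
    k-graph with edge set [E] occurs exactly once in [H], and different such
    [E] are not isomorphic.  The sets [E] that a given [s] maps into [H] are
    those avoiding [F] and its preimage under [s], so there are
    [2^(N - 2m + c s)] of them, where [c s], called [selfmeet] below, is the
    number of members of [F] that [s] maps into [F].  A union bound
    ([num_unique_lower]) thus gives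
    [num_unique H >= 2^(N-m) - 2^(N-2m) * sum_(s != 1) 2^(c s)].
    If the last sum is at most [(1 + eps) n!], then with [l = n!/2^m] this says
    [f(H) >= l - (1 + eps) l^2].  As [m] has to be an integer, [l] can only be
    confined to an interval whose ends differ by a factor 2; on [1/3, 2/3] the
    function [l - l^2] is at least 2/9, with equality at both ends.

    It remains to find [F].  A random choice of its members one after the
    other, derandomised with the potential [sum_s 2^(c s)], multiplies the term
    of [s] in each step by a factor that is on average at most
    [r s = (N + fix s + 3 m) / (N - m)], where [fix s] counts the k-sets that
    [s] maps to themselves ([exists_small_selfmeet]).  So the claim is that
    [sum_(s != 1) (r s)^m <= (1 + eps) n!] for large [n] ([sum_tilt_le]).  If
    [s] has [t] fixed points, then [fix s / N] exceeds [(t/n)^3] at most by an error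
    that is negligible even in the power [m], which is about [n log2 n]
    ([card_invariant_ksets]; this is where [k >= 3] enters).  At most [n!/t!]
    permutations have [t] fixed points, so with [L = ln n] three ranges of [t]
    matter:
    - if [t^2 <= n], then [m (t/n)^3] tends to 0 and [(r s)^m] is [1 + o(1)];
      these permutations account for the main term;
    - if [sqrt n < t <= n/2], then [(r s)^m <= exp (2/5 L t + O(t))], which
      loses against [t! >= exp (t L / 2 - t)];
    - if [t >= n/2], then [r s] is at most about [2 exp (- 7/8 (n - t)/n)], and
      [(r s)^m] is at most [2^m exp (- (9/8) (L - O(1)) (n - t))]; here [2^m]
      is of the order of [n!], and the exponential outweighs
      [n!/t! <= exp (L (n - t))].
    The last two ranges contribute two geometric series with a ratio that tends
    to 0. *)

(** * Invariant k-sets and fixed points *)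

Lemma card_bigcup_le (I T : finType) (A : {set I}) (F : I -> {set T}) :
  #|\bigcup_(i in A) F i| <= \sum_(i in A) #|F i|.
Proof.
elim/big_rec2: _ => [|i m B _ IH]; first by rewrite cards0.
by rewrite (leq_trans (leq_card_setU _ _)) // leq_add2l.
Qed.

(** Picking the [j] prescribed elements one at a time, each is hit with
    probability at most [k/n]. *)
Lemma bin_sub_ratio (n k j : nat) : j <= k -> k <= n ->
  'C(n - j, k - j) * n ^ j <= 'C(n, k) * k ^ j.
Proof.
elim: j => [|j IHj] jk kn; first by rewrite !subn0 !expn0.
have IH := IHj (ltnW jk) kn.
have step : 'C(n - j.+1, k - j.+1) * n <= 'C(n - j, k - j) * k.
  have D := mul_bin_diag (n - j) (k - j.+1).
  rewrite -[(n - j).-1]subnS -[(k - j.+1).+1]/((k - j.+1).+1) subnSK // in D.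
  have pos : 0 < n - j by lia.
  rewrite -(leq_pmul2l pos) mulnA D.
  move: D pos; move: 'C(n - j, k - j) => C _ _.
  suff : (k - j) * n <= (n - j) * k by nia.
  by nia.
rewrite !expnS mulnA (leq_trans (leq_mul step (leqnn _))) //.
by rewrite mulnAC [X in _ <= X]mulnCA mulnC leq_mul2l IH orbT.
Qed.

(** A random k-set contains [B] with probability at most [(k/n)^#|B|]. *)
Lemma card_ksets_above (T : finType) (k : nat) (B : {set T}) : k <= #|T| ->
  #|[set e : {set T} | (#|e| == k) && (B \subset e)]| * #|T| ^ #|B|
    <= 'C(#|T|, k) * k ^ #|B|.
Proof.
move=> kT; have [Bk|kB] := leqP #|B| k; last first.
  rewrite (_ : [set e | _] = set0) ?cards0 //; apply/setP => e; rewrite !inE.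
  by apply/negP => /andP[/eqP ek /subset_leq_card]; rewrite ek leqNgt kB.
apply: leq_trans (bin_sub_ratio Bk kT); rewrite leq_mul2r; apply/orP; right.
have -> : #|T| - #|B| = #|~: B| by rewrite [RHS]cardsCs setCK.
rewrite -cards_draws -(@card_in_imset _ _ (fun e => e :\: B)).
  apply/subset_leq_card/subsetP => _ /imsetP[e + ->].
  rewrite !inE => /andP[/eqP ek Be]; rewrite subsetDr /= cardsD ek.
  by rewrite (setIidPr Be) eqxx.
move=> e f; rewrite !inE => /andP[_ Be] /andP[_ Bf] ef.
by rewrite -(setID e B) -(setID f B) ef (setIidPr Be) (setIidPr Bf).
Qed.

(** A random k-set lies in a given t-subset with probability at most
    [(t/n)^k]; only the exponent 3 is kept, as it suffices for every [k >= 3]. *)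
Lemma bin_cube_ratio (t n k : nat) : 3 <= k -> t <= n ->
  'C(t, k) * n ^ 3 <= 'C(n, k) * t ^ 3.
Proof.
move=> k3 tn; rewrite -(leq_pmul2r (fact_gt0 k)) mulnAC bin_ffact.
rewrite [X in _ <= X]mulnAC bin_ffact.
rewrite -(subnK k3); elim: (k - 3) => [|j IH].
  rewrite add0n; elim: 3 => [|j IH]; first by rewrite !ffactn0 !expn0.
  rewrite !ffactnSr !expnSr mulnACA [X in _ <= X]mulnACA leq_mul //.
  by rewrite !mulnBl [n * t]mulnC leq_sub2l // leq_mul2l tn orbT.
rewrite addSn !ffactnSr mulnAC [X in _ <= X]mulnAC leq_mul //; exact: leq_sub2r.
Qed.

Definition ksets (k : nat) (T : finType) : {set {set T}} :=
  [set e : {set T} | #|e| == k].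

Lemma card_ksets (k : nat) (T : finType) : #|ksets k T| = 'C(#|T|, k).
Proof. exact: card_draws. Qed.

Definition nfix (T : finType) (s : {perm T}) : nat := #|[set x | s x == x]|.

Lemma nfix_lt (T : finType) (s : {perm T}) : s != 1%g -> nfix s < #|T|.
Proof.
apply: contraR; rewrite -leqNgt => ns; apply/eqP/permP => x; rewrite perm1.
have /eqP : [set x | s x == x] == [set: T] by rewrite eqEcard subsetT cardsT.
by move=> /setP/(_ x); rewrite !inE => /eqP.
Qed.

(** Choose the fixed points, then permute the rest:
    ['C(n, t) * (n - t)! = n!/t!]. *)
Lemma card_perm_nfix (T : finType) (t : nat) :
  #|[set s : {perm T} | nfix s == t]| * t`! <= #|T|`!.
Proof.
have [tT|Tt] := leqP t #|T|; last first.
  rewrite (_ : [set s | _] = set0) ?cards0 //; apply/setP => s; rewrite !inE.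
  by apply/negP => /eqP st; move: Tt; rewrite -st ltnNge max_card.
pose D := [set A : {set T} | A \subset [set: T] & #|A| == t].
have sub : [set s : {perm T} | nfix s == t]
    \subset \bigcup_(A in D) [set s : {perm T} | perm_on (~: A) s].
  apply/subsetP => s; rewrite inE => st; apply/bigcupP.
  exists [set x | s x == x]; first by rewrite inE subsetT.
  by rewrite inE; apply/subsetP => x; rewrite !inE.
rewrite -(bin_fact tT) [t`! * _]mulnC mulnA leq_mul2r; apply/orP; right.
rewrite (leq_trans (subset_leq_card sub)) // (leq_trans (card_bigcup_le _ _)) //.
rewrite -[X in 'C(X, _)]cardsT -cards_draws -sum_nat_const leq_sum // => A.
rewrite inE subsetT => /eqP At; rewrite cardsE card_perm.
by rewrite [#|~: A|]cardsCs setCK At.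
Qed.

(** An invariant k-set [e] that is not made of fixed points contains some moved
    [x], hence [s x], and, as [k >= 3], a third point.  So it contains one of
    [{x, s x, z}] with [z] fixed, [{x, s x, s (s x)}], or [{x, s x, z, s z}]
    with [z] moved.  With [u] moved and [t] fixed points there are at most
    [u t], [u] and [u n] such sets, and each of them is contained in a
    [(k/n)^3], [(k/n)^3] and [(k/n)^4] proportion of all k-sets.  A third
    point is essential: the sets containing some [{x, s x}] are too many by
    a factor of order [n] when [t] is bounded. *)
Lemma card_invariant_ksets (T : finType) (k : nat) (s : {perm T}) :
  3 <= k -> k <= #|T| ->
  #|[set e in ksets k T | s @: e == e]| * #|T| ^ 3
    <= 'C(#|T|, k) * (nfix s ^ 3 + (#|T| - nfix s) * (nfix s + 2) * k ^ 4).
Proof.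
move=> k3 kT.
have -> : [set e in ksets k T | s @: e == e] =
    [set e : {set T} | (#|e| == k) && (s @: e == e)].
  by apply/setP => e; rewrite !inE.
set Fx := [set x | s x == x]; rewrite /nfix -/Fx.
have MC : #|T| - #|Fx| = #|~: Fx| by rewrite [RHS]cardsCs setCK.
rewrite MC; set M := ~: Fx.
pose ab (B : {set T}) := [set e : {set T} | (#|e| == k) && (B \subset e)].
pose A0 := [set e : {set T} | (e \subset Fx) && (#|e| == k)].
pose A1 x := \bigcup_(z in Fx) ab [set x; s x; z].
pose A2 x := if s (s x) == x then set0 else ab [set x; s x; s (s x)].
pose A3 x := \bigcup_(z in [set z in M | (z \notin [set x; s x])
                 && (s z \notin [set x; s x])]) ab [set x; s x; z; s z].
have sub : [set e : {set T} | (#|e| == k) && (s @: e == e)]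
    \subset A0 :|: \bigcup_(x in M) (A1 x :|: A2 x :|: A3 x).
  apply/subsetP => e; rewrite !inE => /andP[ek /eqP se].
  have [eF|] := boolP (e \subset Fx); first by rewrite ek.
  have sP y : y \in e -> s y \in e by move=> ye; rewrite -se imset_f.
  case/subsetPn => x xe xF /=; apply/bigcupP; exists x; first by rewrite inE.
  rewrite !inE /A2.
  have [ssx|ssx] := eqVneq (s (s x)) x; last first.
    rewrite inE ek /=; apply/orP; left; apply/orP; right.
    by apply/subsetP => y; rewrite !inE -orbA => /or3P[] /eqP->; rewrite ?sP.
  have [z ze zx] : exists2 z, z \in e & z \notin [set x; s x].
    apply/subsetPn; apply: contraL k3 => /subset_leq_card.
    by rewrite (eqP ek) cards2 -ltnNge; case: eqP => _ /=; lia.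
  have [zF|zF] := boolP (z \in Fx).
    apply/orP; left; apply/orP; left; apply/bigcupP; exists z => //.
    rewrite inE ek; apply/subsetP => y.
    by rewrite !inE -orbA => /or3P[] /eqP->; rewrite ?sP.
  apply/orP; right; apply/bigcupP; exists z.
    move: zF zx; rewrite !inE !negb_or => -> /andP[z1 z2].
    have -> : (s z == x) = (z == s x) by rewrite -{1}ssx (inj_eq perm_inj).
    by rewrite (inj_eq perm_inj) z1 z2.
  rewrite inE ek; apply/subsetP => y.
  by rewrite !inE -!orbA => /or4P[] /eqP->; rewrite ?sP.
have MF x : x \in M -> s x != x by rewrite !inE.
have b3 (B : {set T}) : #|B| = 3 ->
    #|ab B| * #|T| ^ 3 <= 'C(#|T|, k) * k ^ 4.
  move=> B3; have := card_ksets_above B kT; rewrite B3 => /leq_trans -> //.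
  by rewrite leq_mul2l leq_pexp2l ?orbT //; lia.
have b1 x : x \in M -> #|A1 x| * #|T| ^ 3 <= #|Fx| * ('C(#|T|, k) * k ^ 4).
  move=> xM; apply: (@leq_trans ((\sum_(z in Fx) #|ab [set x; s x; z]|) * #|T| ^ 3)).
    by rewrite leq_mul2r card_bigcup_le orbT.
  rewrite big_distrl -sum_nat_const /= leq_sum // => z zF; apply: b3.
  rewrite -setUA cardsU1 cards2 !inE [s x == z]eq_sym negb_or eq_sym (MF x xM).
  have -> : z != s x.
    apply/eqP => zsx; move: zF (MF x xM); rewrite !inE zsx.
    by rewrite (inj_eq perm_inj) => /eqP->; rewrite eqxx.
  have -> // : x != z by apply: contraNneq (MF x xM) => ->; move: zF; rewrite inE.
have b2 x : x \in M -> #|A2 x| * #|T| ^ 3 <= 'C(#|T|, k) * k ^ 4.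
  move=> xM; rewrite /A2; case: ifPn => [_|ssx]; first by rewrite cards0.
  apply: b3; rewrite -setUA cardsU1 cards2 !inE (inj_eq perm_inj) negb_or.
  by rewrite ![x == _]eq_sym (MF x xM) ssx.
have b4 x : x \in M -> #|A3 x| * #|T| ^ 3 <= 'C(#|T|, k) * k ^ 4.
  move=> xM; have [T0|Tpos] := posnP #|T|; first by lia.
  rewrite -(leq_pmul2l Tpos).
  apply: (@leq_trans (\sum_(z in [set z in M | (z \notin [set x; s x])
                 && (s z \notin [set x; s x])]) ('C(#|T|, k) * k ^ 4))); last first.
    by rewrite sum_nat_const leq_mul2r max_card orbT.
  rewrite mulnCA -expnS.
  apply: (@leq_trans ((\sum_(z in [set z in M | (z \notin [set x; s x])
                 && (s z \notin [set x; s x])]) #|ab [set x; s x; z; s z]|) * #|T| ^ 4)).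
    by rewrite leq_mul2r card_bigcup_le orbT.
  rewrite big_distrl /= leq_sum // => z; rewrite inE => /and3P[zM z1 z2].
  have := card_ksets_above [set x; s x; z; s z] kT.
  suff -> : #|[set x; s x; z; s z]| = 4 by [].
  have -> : [set x; s x; z; s z] = z |: (s z |: [set x; s x]).
    by apply/setP => y; rewrite !inE; do !case: (_ == _).
  rewrite cardsU1 cardsU1 cards2 z2 [x == _]eq_sym (MF x xM) /= in_setU1.
  by rewrite (negbTE z1) orbF [z == _]eq_sym (MF z zM).
apply: leq_trans (_ : (#|A0| + \sum_(x in M) (#|A1 x| + #|A2 x| + #|A3 x|))
   * #|T| ^ 3 <= _).
  rewrite leq_mul2r (leq_trans (subset_leq_card sub)) ?orbT //.
  rewrite (leq_trans (leq_card_setU _ _)) // leq_add2l.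
  rewrite (leq_trans (card_bigcup_le _ _)) // leq_sum // => x _.
  rewrite (leq_trans (leq_card_setU _ _)) // leq_add2r.
  exact: leq_card_setU.
rewrite mulnDl mulnDr leq_add //.
  by rewrite cards_draws bin_cube_ratio // max_card.
rewrite big_distrl /=.
apply: leq_trans (_ : \sum_(x in M) ((#|Fx| + 2) * ('C(#|T|, k) * k ^ 4)) <= _).
  rewrite leq_sum // => x xM.
  rewrite !mulnDl mul2n -addnn addnA.
  by rewrite !leq_add ?b1 ?b2 ?b4.
by rewrite sum_nat_const mulnA mulnCA.
Qed.

Local Open Scope ring_scope.

(** * Choosing the missing edges *)

Definition selfmeet (U : finType) (g : U -> U) (F : {set U}) : nat :=
  #|[set x in F | g x \in F]|.

(** The pairs [(y, g y)] in [x |: F] that are not in [F] have [y = x] or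
    [g y = x]. *)
Lemma selfmeet_add (U : finType) (g : U -> U) (F : {set U}) (x : U) :
  injective g -> x \notin F ->
  (selfmeet g (x |: F) <=
     selfmeet g F + (g x == x) + (g x \in F) + (x \in g @: F))%N.
Proof.
move=> gI xF; rewrite /selfmeet.
have sub : [set y in x |: F | g y \in x |: F] \subset
    [set y in F | g y \in F] :|: [set y | (y == x) && ((g x == x) || (g x \in F))]
     :|: [set y in F | g y == x].
  apply/subsetP => y; rewrite !inE => /andP[/orP[/eqP->|yF] /orP[gy|gyF]].
  - by rewrite gy eqxx !orbT.
  - by rewrite gyF eqxx !orbT.
  - by rewrite yF gy !orbT.
  - by rewrite yF gyF.
rewrite (leq_trans (subset_leq_card sub)) // (leq_trans (leq_card_setU _ _)) //.
rewrite leq_add //; last first.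
  have [xg|xg] := boolP (x \in g @: F); last first.
    rewrite leqn0 cards_eq0; apply/eqP/setP => y; rewrite !inE.
    by apply/negP => /andP[yF /eqP gy]; move: xg; rewrite -gy imset_f.
  apply/card_le1_eqP => y z; rewrite !inE => /andP[_ /eqP<-] /andP[_ /eqP].
  by move=> /gI.
rewrite -addnA (leq_trans (leq_card_setU _ _)) // leq_add2l.
have [gx|gx] := eqVneq (g x) x; have [gF|gF] := boolP (g x \in F) => /=.
- by rewrite -gx gF in xF.
- by rewrite addn0 -(cards1 x) subset_leq_card //; apply/subsetP => y; rewrite !inE => /andP[].
- by rewrite add0n -(cards1 x) subset_leq_card //; apply/subsetP => y; rewrite !inE => /andP[].
- by rewrite leqn0 cards_eq0; apply/eqP/setP => y; rewrite !inE andbF.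
Qed.

Lemma sum_le_exists (R : realFieldType) (U : finType) (A : {set U}) (h : U -> R) (b : R) :
  (0 < #|A|)%N -> \sum_(x in A) h x <= #|A|%:R * b -> exists2 x, x \in A & h x <= b.
Proof.
move=> A0 hb; apply/exists_inP; apply: contraLR hb; rewrite negb_exists_in.
move=> /forall_inP hA; rewrite -ltNge mulr_natl -sumr_const.
have [x0 x0A] : exists x, x \in A by apply/set0Pn; rewrite -card_gt0.
by apply: ltr_sum => [|x xA]; [apply/hasP; exists x0; rewrite ?mem_index_enum|rewrite ltNge hA].
Qed.

(** Averaged over the new member [x], the weight [2 ^ selfmeet] grows at most by
    the stated factor: it doubles when [g x = x], and it is multiplied by at
    most 2 for each of the events [g x \in F] and [x \in g @: F], each of which
    occurs for at most [m] choices of [x]. *)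
Lemma sum_expn_selfmeet (R : realFieldType) (U : finType) (g : U -> U)
    (X F : {set U}) (m : nat) :
  injective g -> F \subset X -> (#|F| < m)%N -> (m < #|X|)%N ->
  \sum_(x in X :\: F) 2%:R ^+ selfmeet g (x |: F) <=
  #|X :\: F|%:R * ((#|X|%:R + #|[set x in X | g x == x]|%:R + 3 * m%:R)
     / (#|X|%:R - m%:R)) * 2%:R ^+ selfmeet g F :> R.
Proof.
move=> gI FX Fm mX.
have XF : #|X :\: F| = (#|X| - #|F|)%N by rewrite cardsD (setIidPr FX).
have X0 : 0 < #|X|%:R - m%:R :> R by rewrite subr_gt0 ltr_nat.
have Xm : #|X|%:R - m%:R <= #|X :\: F|%:R :> R.
  rewrite XF natrB ?lerB ?ler_nat //; first exact: ltnW.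
  by rewrite (leq_trans (ltnW Fm)) // ltnW.
(* In the three cases 2 <= 1 + 1, 2 <= 1 + 3/2 and 4 <= 1 + 3/2 + 3/2. *)
pose c x : R := (g x == x)%:R + 3 / 2 * (g x \in F)%:R + 3 / 2 * (x \in g @: F)%:R.
have inc x : x \in X :\: F ->
    2%:R ^+ selfmeet g (x |: F) <= (1 + c x) * 2%:R ^+ selfmeet g F.
  rewrite inE => /andP[xF xX].
  apply: le_trans (_ : 2%:R ^+ (selfmeet g F + (g x == x) + (g x \in F) + (x \in g @: F)) <= _).
    by rewrite ler_weXn2l ?ler1n // selfmeet_add.
  rewrite -!addnA exprD mulrC ler_wpM2r ?exprn_ge0 // /c.
  have gF : g x == x -> g x \notin F by move=> /eqP->.
  have gF' : g x == x -> x \notin g @: F.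
    move=> /eqP gx; apply/imsetP => -[y yF /esym]; rewrite -[X in _ = X]gx => /gI yx.
    by rewrite -yx yF in xF.
  case: (g x == x) gF gF' => [/(_ isT)/negbTE-> /(_ isT)/negbTE->|_ _] /=; first by lra.
  by case: (g x \in F); case: (x \in _) => /=; lra.
apply: (@le_trans _ _ (\sum_(x in X :\: F) (1 + c x) * 2%:R ^+ selfmeet g F)).
  exact: ler_sum.
rewrite -mulr_suml ler_wpM2r ?exprn_ge0 //.
have csum : \sum_(x in X :\: F) c x <= #|[set x in X | g x == x]|%:R + 3 * m%:R.
  rewrite /c !big_split /= -!mulr_sumr -!natr_sum -!sum1_card.
  have e1 : (\sum_(x in X :\: F) (g x == x : nat) <= #|[set x in X | g x == x]|)%N.
    rewrite -big_mkcondr -sum1_card /=; rewrite [leqLHS](eq_bigl (mem [set x in X :\: F | g x == x])); last by move=> x; rewrite !inE.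
    by rewrite !sum1_card subset_leq_card //; apply/subsetP => x; rewrite !inE => /andP[/andP[_ ->] ->].
  have e2 : (\sum_(x in X :\: F) (g x \in F : nat) <= m)%N.
    rewrite -big_mkcondr /= [leqLHS](eq_bigl (mem [set x in X :\: F | g x \in F])); last by move=> x; rewrite !inE.
    rewrite sum1_card -(card_imset _ gI) (leq_trans _ (ltnW Fm)) // subset_leq_card //.
    by apply/subsetP => _ /imsetP[x + ->]; rewrite !inE => /andP[].
  have e3 : (\sum_(x in X :\: F) (x \in g @: F : nat) <= m)%N.
    rewrite -big_mkcondr /= [leqLHS](eq_bigl (mem [set x in X :\: F | x \in g @: F])); last by move=> x; rewrite !inE.
    rewrite sum1_card (leq_trans _ (ltnW Fm)) // -(card_imset (mem F) gI) subset_leq_card //.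
    by apply/subsetP => x; rewrite inE => /andP[].
  rewrite -(ler_nat R) in e1; rewrite -(ler_nat R) in e2; rewrite -(ler_nat R) in e3.
  by rewrite sum1_card; lra.
rewrite big_split /= sumr_const -[_ *+ _]mulr_natl mulr1.
rewrite mulrA ler_pdivlMr //.
have fx0 : 0 <= #|[set x in X | g x == x]|%:R :> R by [].
have m0 : 0 <= m%:R :> R by [].
set D : R := #|X :\: F|%:R in Xm *; set fx : R := (#|_|)%:R in csum fx0 *.
set S : R := \sum_(x in _) c x in csum *.
have XD : D + fx + 3 * m%:R <= #|X|%:R + fx + 3 * m%:R.
  by rewrite !lerD2r ler_nat subset_leq_card // subsetDl.
apply: le_trans (_ : (D + (fx + 3 * m%:R)) * (#|X|%:R - m%:R) <= _).
  by apply: ler_wpM2r; [exact: ltW | rewrite lerD2l].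
have D0 : 0 <= D by [].
have XX : 0 <= #|X|%:R :> R by [].
rewrite mulrDl.
have : (fx + 3 * m%:R) * (#|X|%:R - m%:R) <= (fx + 3 * m%:R) * D.
  by rewrite ler_wpM2l //; lra.
have : D * (#|X|%:R - m%:R) <= D * #|X|%:R by rewrite ler_wpM2l //; lra.
lra.
Qed.

(** The potential is [sum_i 2^(selfmeet (g i) F) * (r i)^(m - #|F|)], with [r i]
    the growth factor of [sum_expn_selfmeet].  Some new member does not
    increase it; it starts as the right-hand side for the empty family and ends
    as the left-hand side when [#|F| = m]. *)
Lemma exists_small_selfmeet (R : realFieldType) (U I : finType) (P : pred I)
    (g : I -> U -> U) (X : {set U}) (m : nat) :
  (forall i, injective (g i)) -> (m < #|X|)%N ->
  exists F : {set U}, [/\ F \subset X, #|F| = m &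
    \sum_(i | P i) 2%:R ^+ selfmeet (g i) F <=
    \sum_(i | P i) ((#|X|%:R + #|[set x in X | g i x == x]|%:R + 3 * m%:R)
       / (#|X|%:R - m%:R)) ^+ m :> R].
Proof.
move=> gI mX.
pose r i : R := (#|X|%:R + #|[set x in X | g i x == x]|%:R + 3 * m%:R)
       / (#|X|%:R - m%:R).
have r0 i : 0 <= r i.
  by apply: divr_ge0; rewrite ?subr_ge0 ?ler_nat 1?ltnW // !addr_ge0 ?mulr_ge0.
suff H j : (j <= m)%N -> exists F : {set U}, [/\ F \subset X, #|F| = j &
    \sum_(i | P i) 2%:R ^+ selfmeet (g i) F * r i ^+ (m - j) <=
    \sum_(i | P i) r i ^+ m].
  have [F [FX Fm le]] := H m (leqnn m); exists F; split=> //.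
  by move: le; rewrite subnn; under eq_bigr do rewrite expr0 mulr1.
elim: j => [|j IH] jm.
  exists set0; rewrite sub0set cards0; split=> //; rewrite subn0 ler_sum // => i _.
  rewrite /selfmeet (_ : [set _ in _ | _] = set0) ?cards0 ?expr0 ?mul1r //.
  by apply/setP => x; rewrite !inE.
have [F [FX Fj le]] := IH (ltnW jm).
have XF : #|X :\: F| = (#|X| - #|F|)%N by rewrite cardsD (setIidPr FX).
have [x xXF hx] : exists2 x, x \in X :\: F &
    \sum_(i | P i) 2%:R ^+ selfmeet (g i) (x |: F) * r i ^+ (m - j.+1) <=
    \sum_(i | P i) 2%:R ^+ selfmeet (g i) F * r i ^+ (m - j).
  apply: sum_le_exists; first by rewrite XF subn_gt0 Fj (leq_trans jm) // ltnW.
  rewrite exchange_big /= mulr_sumr ler_sum // => i _.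
  rewrite -mulr_suml -(subnSK jm) exprS [2%:R ^+ _ * _]mulrCA.
  rewrite [r i * _]mulrA !mulrA ler_wpM2r ?exprn_ge0 //.
  have Fm : (#|F| < m)%N by rewrite Fj.
  by rewrite -[#|_|%:R * _ / _]mulrA; apply: sum_expn_selfmeet.
exists (x |: F); split.
- by rewrite subUset sub1set FX; move: xXF; rewrite inE => /andP[_ ->].
- by rewrite cardsU1 Fj; move: xXF; rewrite inE => /andP[-> _].
- exact: le_trans le.
Qed.

Local Close Scope ring_scope.

(** * Unique subhypergraphs of a cofamily *)

Section Cofamily.
Variables (k : nat) (T : finType) (F : {set {set T}}).

Let X := ksets k T.

Lemma kgraph_subproof (E : {set {set T}}) : is_kgraph k ([set: T], E :&: X).
Proof.
by apply/forall_inP => e /=; rewrite !inE subsetT => /andP[_ ->].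
Qed.

(** Intersecting with [X] makes the construction total. *)
Definition spanning_kgraph (E : {set {set T}}) : kgraph k T :=
  KGraph (kgraph_subproof E).

(** An injection of the whole finite vertex set into itself is a permutation. *)
Lemma spanning_iso_perm (E : {set {set T}}) (S : kgraph k T) :
  kgraph_iso (spanning_kgraph E) S ->
  vertices S = [set: T] /\
  exists s : {perm T}, edges S = [set s @: (e : {set T}) | e in E :&: X].
Proof.
move=> /kgraph_isoP[f [fI fV fE]].
have fi : injective f by move=> x y; apply: fI; rewrite !inE.
split.
  rewrite -fV; apply/setP => y; rewrite inE; apply/imsetP.
  by exists (invF fi y); rewrite ?inE ?f_invF.
exists (perm fi); rewrite -fE; apply: eq_imset => e; apply: eq_imset => x.
by rewrite permE.
Qed.

(** The condition on [E] excludes a second copy of [E] in the cofamily and also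
    a nontrivial automorphism of [E]: both count in the union bound of
    [rigid_count], and ruling out the latter costs nothing there. *)
Definition rigid_avoiders : {set {set {set T}}} :=
  [set E in powerset (X :\: F) |
     [forall s : {perm T}, ([set s @: (e : {set T}) | e in E] \subset X :\: F)
        ==> (s == 1%g)]].

Lemma rigid_avoidersP (E : {set {set T}}) (s : {perm T}) :
  E \in rigid_avoiders -> [set s @: (e : {set T}) | e in E] \subset X :\: F ->
  [set s @: (e : {set T}) | e in E] = E.
Proof.
rewrite inE => /andP[_ /forallP/(_ s)/implyP sE] /sE/eqP->.
rewrite -[RHS]imset_id; apply: eq_imset => e; rewrite -[RHS]imset_id.
by apply: eq_imset => x; rewrite perm1.
Qed.

Lemma rigid_sub (E : {set {set T}}) :
  E \in rigid_avoiders -> E \subset X :\: F.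
Proof. by rewrite inE powersetE => /andP[]. Qed.

Lemma rigid_edges (E : {set {set T}}) : E \in rigid_avoiders -> E :&: X = E.
Proof.
by move=> /rigid_sub EX; apply/setIidPl/(subset_trans EX)/subsetDl.
Qed.

Lemma kgraph_eq (G H : kgraph k T) :
  vertices G = vertices H -> edges G = edges H -> G = H.
Proof.
rewrite /vertices /edges => h1 h2; apply: val_inj => /=.
by rewrite [LHS]surjective_pairing h1 h2 -surjective_pairing.
Qed.

Lemma rigid_iso_eq (E : {set {set T}}) (S : kgraph k T) :
  E \in rigid_avoiders -> edges S \subset X :\: F ->
  kgraph_iso (spanning_kgraph E) S -> S = spanning_kgraph E.
Proof.
move=> ER SX /spanning_iso_perm[SV [s Ss]]; apply: kgraph_eq => //.
rewrite {2}/edges /= Ss rigid_edges //; apply: rigid_avoidersP => //.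
by rewrite Ss rigid_edges in SX.
Qed.

Let H := spanning_kgraph (X :\: F).

Lemma edges_H : edges H = X :\: F.
Proof. by rewrite /edges /=; apply/setIidPl/subsetDl. Qed.

Lemma rigid_unique (E : {set {set T}}) :
  E \in rigid_avoiders -> unique_subhypergraph (spanning_kgraph E) H.
Proof.
move=> ER; rewrite /unique_subhypergraph; apply/cards1P.
exists (spanning_kgraph E); apply/setP => S; rewrite !inE.
apply/andP/eqP => [[/andP[_ SH] iso]|->]; last first.
  rewrite kgraph_iso_refl; split=> //; rewrite /subhypergraph subxx /= edges_H.
  by rewrite /edges /= rigid_edges // rigid_sub.
by apply: rigid_iso_eq iso; rewrite // -edges_H.
Qed.

Lemma rigid_le_num_unique : #|rigid_avoiders| <= num_unique H.
Proof.
rewrite /num_unique; set D := [set G | _].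
have inD E : E \in rigid_avoiders -> spanning_kgraph E \in D.
  by move=> ER; rewrite inE rigid_unique // andbT /vertices /=.
pose h E := [set G in D | kgraph_iso (spanning_kgraph E) G].
rewrite -(@card_in_imset _ _ h) => [|E E' ER ER' hE].
  apply/subset_leq_card/subsetP => _ /imsetP[E ER ->].
  by apply/imsetP; exists (spanning_kgraph E); rewrite ?inD.
have : spanning_kgraph E' \in h E by rewrite hE inE inD // kgraph_iso_refl.
rewrite inE => /andP[_ /(rigid_iso_eq ER)].
have E'X : edges (spanning_kgraph E') \subset X :\: F.
  by rewrite /edges /= rigid_edges // rigid_sub.
move=> /(_ E'X) /(congr1 (@edges k T)); rewrite /edges /= !rigid_edges //.
Qed.

(** Union bound over the permutations that prevent a set from being rigid.  The
    terms are multiplied by [2 ^ (2 * #|F|)] to keep all exponents natural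
    numbers. *)
Lemma rigid_count : F \subset X ->
  2 ^ #|X| * 2 ^ #|F| <= #|rigid_avoiders| * 2 ^ (2 * #|F|) +
   2 ^ #|X| * \sum_(s : {perm T} | s != 1%g) 2 ^ selfmeet (fun e : {set T} => s @: e) F.
Proof.
move=> FX.
pose pre (s : {perm T}) := [set e : {set T} | s @: e \in F].
pose bad (s : {perm T}) := powerset (X :\: (F :|: pre s)).
have sub : powerset (X :\: F) \subset
    rigid_avoiders :|: \bigcup_(s in [set s | s != 1%g]) bad s.
  apply/subsetP => E EX; rewrite !inE; rewrite powersetE in EX; rewrite EX /=.
  rewrite -implyNb; apply/implyP; rewrite negb_forall => /existsP[s].
  rewrite negb_imply => /andP[sE s1]; apply/bigcupP; exists s; rewrite ?inE //; apply/subsetP => e eE.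
  have := subsetP EX e eE.
  rewrite !inE negb_or => /andP[-> ->]; rewrite !andbT.
  by have /(subsetP sE) := imset_f (fun e : {set T} => s @: e) eE; rewrite inE => /andP[].
have := subset_leq_card sub; rewrite card_powerset => cnt.
have {}cnt := leq_trans cnt (leq_card_setU _ _).
have {cnt} := leq_trans cnt (leq_add (leqnn _) (card_bigcup_le _ _)).
rewrite -(leq_pmul2r (expn_gt0 2 (2 * #|F|))) mulnDl => cnt.
have XF : #|X :\: F| + #|F| = #|X|.
  by rewrite cardsD (setIidPr FX) subnK // subset_leq_card.
have e1 : 2 ^ #|X :\: F| * 2 ^ (2 * #|F|) = 2 ^ #|X| * 2 ^ #|F|.
  by rewrite -!expnD -XF; congr (2 ^ _); lia.
rewrite e1 in cnt; apply: (leq_trans cnt); rewrite leq_add2l.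
rewrite big_distrl big_distrr /= (eq_bigl (fun s => s != 1%g)); last by move=> s; rewrite inE.
apply: leq_sum => s _; rewrite card_powerset -!expnD leq_exp2l //.
have iI : injective (fun e : {set T} => s @: e) by apply: imset_inj; apply: perm_inj.
have preX : pre s \subset X.
  by apply/subsetP => e; rewrite inE => /(subsetP FX); rewrite !inE card_imset //; apply: perm_inj.
have preF : #|pre s| = #|F|.
  rewrite -(card_imset _ iI); congr #|pred_of_set _|; apply/setP => e.
  apply/imsetP/idP => [[f + ->]|eF]; first by rewrite inE.
  have es : e = s @: ((s^-1)%g @: e).
    rewrite -imset_comp -[LHS]imset_id; apply: eq_imset => x /=.
    by rewrite permKV.
  by exists ((s^-1)%g @: e); rewrite ?inE -?es.
have sm : selfmeet (fun e : {set T} => s @: e) F = #|F :&: pre s|.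
  by rewrite /selfmeet; congr #|pred_of_set _|; apply/setP => e; rewrite !inE.
have UX : F :|: pre s \subset X by rewrite subUset FX.
have := subset_leq_card UX.
rewrite cardsD (setIidPr UX) sm cardsU preF.
have := subset_leq_card (subsetIl F (pre s)). move: #|F :&: pre s| #|F| #|X| => c f x; lia.
Qed.

End Cofamily.

Lemma num_unique_lower (k : nat) (T : finType) (F : {set {set T}}) :
  F \subset ksets k T -> exists H : kgraph k T, vertices H = [set: T] /\
  2 ^ 'C(#|T|, k) * 2 ^ #|F| <= num_unique H * 2 ^ (2 * #|F|) +
   2 ^ 'C(#|T|, k) * \sum_(s : {perm T} | s != 1%g) 2 ^ selfmeet (fun e : {set T} => s @: e) F.
Proof.
move=> FX; exists (spanning_kgraph k (ksets k T :\: F)); split=> //.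
have := rigid_count FX; rewrite card_ksets => /leq_trans -> //.
by rewrite leq_add2r leq_mul2r rigid_le_num_unique orbT.
Qed.

Local Open Scope ring_scope.

(** * Estimates for the growth factor *)

(** The upper bound of [card_invariant_ksets] for the proportion of k-sets
    invariant under a permutation with [t] fixed points, with [K = k ^ 4]. *)
Definition fixfrac (R : realFieldType) (K n t : R) : R :=
  (t ^+ 3 + (n - t) * (t + 2) * K) / n ^+ 3.

(** What is needed of a large [n]: [L] is [ln n], [K] is [k ^ 4], [N] is the
    number of k-sets, and [h] is a small constant.  The inequality [ls_L] says
    that [L] is large in terms of [h] and [k]; all error terms turn out to be
    at most [O(K / L)], and 6000 covers the constants. *)
Record large_scale (R : realFieldType) (h K n L m N : R) : Prop := LargeScale {
  ls_h : 0 < h; ls_h1 : h <= 1 / 4; ls_K : 1 <= K; ls_L : 60 * 100 * K <= h * L;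
  ls_n : L ^+ 4 <= 16 * 16 * n; ls_m1 : 1 <= m; ls_m : m <= 8 / 5 * (n * L);
  ls_N : n ^+ 3 <= N * K }.

Lemma ls_basic (R : realFieldType) (h K n L m N : R) : large_scale h K n L m N ->
  [/\ 60 * 100 <= L, L ^+ 2 <= n, 60 * 100 * (L * K) <= h * n & 0 < N].
Proof.
case=> h0 h1 K1 hL nL m1 mL nN.
have hLL : h * L <= L by nra.
have L6 : 60 * 100 <= L by lra.
have Ln : L ^+ 2 <= n.
  suff : 16 * 16 * L ^+ 2 <= 16 * 16 * n by lra.
  apply: le_trans nL.
  have -> : L ^+ 4 = L ^+ 2 * L ^+ 2 by ring.
  by rewrite ler_wpM2r ?sqr_ge0 //; nra.
split=> //.
  apply: le_trans (_ : h * L ^+ 2 <= _); last by rewrite ler_wpM2l // ltW.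
  have -> : h * L ^+ 2 = L * (h * L) by ring.
  by rewrite mulrCA; apply: ler_wpM2l => //; lra.
have n0 : 0 < n by apply: lt_le_trans Ln; rewrite exprn_gt0 //; lra.
have : 0 < N * K by apply: lt_le_trans nN; rewrite exprn_gt0.
by rewrite pmulr_lgt0 //; lra.
Qed.

(** The growth factor [r s] is [1 + fix s / N] up to an error of order [m/N]. *)
Lemma tilt_base_le (R : realFieldType) (N m phi : R) :
  0 < N -> 0 <= m -> 8 * m <= N -> phi <= 2 ->
  (N + N * phi + 3 * m) / (N - m) <= 1 + phi + 8 * m / N.
Proof.
move=> N0 m0 mN p2; rewrite ler_pdivrMr; last by lra.
set d := 8 * m / N.
have dN : d * N = 8 * m by rewrite /d mulfVK // lt0r_neq0.
have d1 : d <= 1 by rewrite /d ler_pdivrMr // mul1r.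
nra.
Qed.

(** [m^2/N] is at most of order [L^2/n], hence of order [1/L^2]. *)
Lemma tilt_correction_le (R : realFieldType) (h K n L m N : R) :
  large_scale h K n L m N -> m * (8 * m / N) <= h.
Proof.
move=> ls; have [L6 Ln LK N0] := ls_basic ls.
case: ls => h0 h1 K1 hL nL m1 mL nN.
have n0 : 0 < n by apply: lt_le_trans Ln; rewrite exprn_gt0 //; lra.
rewrite mulrA ler_pdivrMr //.
have m2 : m * (8 * m) <= 8 * (8 / 5) ^+ 2 * (n * L) ^+ 2.
  have : m ^+ 2 <= (8 / 5 * (n * L)) ^+ 2.
    rewrite lerXn2r // nnegrE; first lra.
    by rewrite mulr_ge0 ?mulr_ge0 //; lra.
  rewrite exprMn; lra.
have L2 : 0 < L ^+ 2 by rewrite exprn_gt0 //; lra.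
rewrite -(ler_pM2r L2).
apply: (le_trans (ler_wpM2r (ltW L2) m2)).
have -> : 8 * (8 / 5) ^+ 2 * (n * L) ^+ 2 * L ^+ 2 = 8 * (8 / 5) ^+ 2 * n ^+ 2 * L ^+ 4 :> R by ring.
have n2 : 0 <= 8 * (8 / 5) ^+ 2 * n ^+ 2 :> R by rewrite mulr_ge0 ?exprn_ge0 //; lra.
apply: (le_trans (ler_wpM2l n2 nL)).
apply: le_trans (_ : 60 * 100 * (N * K) <= _).
  have n3 : 0 < n ^+ 3 by rewrite exprn_gt0.
  have e3 : n ^+ 3 = n ^+ 2 * n by ring.
  lra.
have -> : 60 * 100 * (N * K) = N * (60 * 100 * K) by ring.
have -> : h * N * L ^+ 2 = N * (h * L * L) by ring.
rewrite ler_wpM2l ?ltW //; nra.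
Qed.

Lemma fixfrac_error_le (R : realFieldType) (h K n L m N s t : R) :
  large_scale h K n L m N -> 0 <= s -> 0 <= t ->
  m * (s * (t + 2) * K / n ^+ 3) <= 8 / 5 * (L * K) * (s * (t + 2) / n ^+ 2).
Proof.
move=> ls s0 t0; have [L6 Ln LK N0] := ls_basic ls.
case: ls => h0 h1 K1 _ _ m1 mL _.
have n0 : 0 < n by apply: lt_le_trans Ln; rewrite exprn_gt0 //; lra.
rewrite mulrA ler_pdivrMr ?exprn_gt0 //.
have -> : 8 / 5 * (L * K) * (s * (t + 2) / n ^+ 2) * n ^+ 3
    = (s * (t + 2)) * (8 / 5 * (n * L) * K) by field; rewrite lt0r_neq0.
rewrite mulrCA ler_wpM2l ?mulr_ge0 ?addr_ge0 // ler_wpM2r //; lra.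
Qed.

Lemma ls_n1 (R : realFieldType) (h K n L m N : R) :
  large_scale h K n L m N -> 60 * 100 <= n.
Proof. by move=> ls; have [L6 Ln _ _] := ls_basic ls; nra. Qed.

Lemma fixfrac_le2 (R : realFieldType) (h K n L m N t : R) :
  large_scale h K n L m N -> 0 <= t <= n -> fixfrac K n t <= 2.
Proof.
move=> ls /andP[t0 tn]; have [L6 Ln LK N0] := ls_basic ls.
have n6 := ls_n1 ls; case: ls => h0 h1 K1 hL _ m1 _ _.
rewrite /fixfrac ler_pdivrMr ?exprn_gt0 //; last by lra.
have t3 : t ^+ 3 <= n ^+ 3 by rewrite lerXn2r // nnegrE //; lra.
have st : (n - t) * (t + 2) <= n * (2 * n) by apply: ler_pM; lra.
have K2 : 2 * K <= n by nra.
have st0 : 0 <= n * (2 * n) by nra.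
have : (n - t) * (t + 2) * K <= n * (2 * n) * K by apply: ler_wpM2r => //; lra.
have : n ^+ 2 * (2 * K) <= n ^+ 2 * n by apply: ler_wpM2l => //; rewrite exprn_ge0 //; lra.
lra.
Qed.

(** Both [m (t/n)^3] and [m] times the error term are of order [L (t + 1) / n],
    which is [O(1/L)] because [(L t)^2 <= L^2 n <= 256 n^2 / L^2]. *)
Lemma fixfrac_exponent_few (R : realFieldType) (h K n L m N t : R) :
  large_scale h K n L m N -> 0 <= t -> t ^+ 2 <= n -> m * fixfrac K n t <= h.
Proof.
move=> ls t0 tn; have [L6 Ln LK N0] := ls_basic ls; have n6 := ls_n1 ls.
have tn' : t <= n by nra.
have := @fixfrac_error_le R h K n L m N (n - t) t ls.
rewrite subr_ge0 => /(_ tn' t0) err.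
case: ls => h0 h1 K1 hL nL m1 mL _.
have n0 : 0 < n by lra.
rewrite /fixfrac mulrDl mulrDr.
have Lt : L * t <= 16 * n / L.
  rewrite ler_pdivlMr; last by lra.
  have : (L * t * L) ^+ 2 <= (16 * n) ^+ 2.
    have -> : (L * t * L) ^+ 2 = L ^+ 4 * t ^+ 2 by ring.
    have -> : (16 * n) ^+ 2 = (16 * 16 * n) * n by ring.
    by apply: ler_pM => //; rewrite ?exprn_ge0 //; lra.
  by rewrite ler_pXn2r // nnegrE ?mulr_ge0 //; lra.
have hL' : 60 * 100 / L <= h.
  rewrite ler_pdivrMr; last by lra.
  by lra.
have Lt' : L * t <= h * n / 30.
  have -> : h * n / 30 = h * (n / 30) by field.
  apply: (le_trans Lt); have -> : 16 * n / L = (60 * 100 / L) * (n * (16 / (60 * 100))) by field; lra.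
  by apply: ler_pM; rewrite ?divr_ge0 //; lra.
have main : m * (t ^+ 3 / n ^+ 3) <= h / 2.
  rewrite mulrA ler_pdivrMr ?exprn_gt0 //.
  have -> : t ^+ 3 = t * t ^+ 2 by ring.
  apply: le_trans (_ : (8 / 5 * (n * L)) * (t * n) <= _).
    apply: ler_pM; rewrite ?mulr_ge0 ?exprn_ge0 //; try lra.
    by apply: ler_pM; rewrite ?exprn_ge0.
  have -> : 8 / 5 * (n * L) * (t * n) = n ^+ 2 * (8 / 5 * (L * t)) by ring.
  have -> : h / 2 * n ^+ 3 = n ^+ 2 * (h * n / 2) by ring.
  have hn0 : 0 <= h * n by rewrite mulr_ge0 //; lra.
  by rewrite ler_wpM2l ?exprn_ge0 //; lra.
have KLt : L * K * (t + 2) <= h * n / 25.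
  have : K * (L * t) <= K * (16 * n / L) by apply: ler_wpM2l => //; lra.
  have -> : K * (16 * n / L) = 60 * 100 * K / L * (n * (16 / (60 * 100))) by field; lra.
  have : 60 * 100 * K / L <= h by rewrite ler_pdivrMr //; lra.
  move=> hK; have : 60 * 100 * K / L * (n * (16 / (60 * 100))) <= h * (n * (16 / (60 * 100))).
    by apply: ler_wpM2r => //; lra.
  have hn0 : 0 <= h * n by rewrite mulr_ge0 //; lra.
  lra.
have e2 : 8 / 5 * (L * K) * ((n - t) * (t + 2) / n ^+ 2) <= h / 2.
  have -> : 8 / 5 * (L * K) * ((n - t) * (t + 2) / n ^+ 2) =
    8 / 5 * ((n - t) * (L * K * (t + 2))) / n ^+ 2 by field; lra.
  rewrite ler_pdivrMr ?exprn_gt0 //.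
  have : (n - t) * (L * K * (t + 2)) <= n * (h * n / 25).
    by apply: ler_pM => //; rewrite ?mulr_ge0 //; lra.
  have : 0 <= h * n ^+ 2 by rewrite mulr_ge0 ?exprn_ge0 //; lra.
  lra.
lra.
Qed.

(** [m (t/n)^3 <= 8/5 L t (t/n)^2] and [t/n <= 1/2]. *)
Lemma fixfrac_exponent_mid (R : realFieldType) (h K n L m N t : R) :
  large_scale h K n L m N -> 1 <= t -> 2 * t <= n ->
  m * fixfrac K n t <= (2 / 5 * L + 1 / 2) * t.
Proof.
move=> ls t1 tn; have [L6 Ln LK N0] := ls_basic ls; have n6 := ls_n1 ls.
have t0 : 0 <= t by lra.
have := @fixfrac_error_le R h K n L m N (n - t) t ls.
rewrite subr_ge0 => /(_ _ t0) err; have {}err := err ltac:(lra).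
case: ls => h0 h1 K1 _ _ m1 mL _.
have n0 : 0 < n by lra.
rewrite /fixfrac mulrDl mulrDr.
have main : m * (t ^+ 3 / n ^+ 3) <= 2 / 5 * L * t.
  rewrite mulrA ler_pdivrMr ?exprn_gt0 //.
  apply: le_trans (_ : (8 / 5 * (n * L)) * t ^+ 3 <= _).
    by rewrite ler_wpM2r ?exprn_ge0.
  have -> : 8 / 5 * (n * L) * t ^+ 3 = (2 / 5 * L * t * n) * (2 * t) ^+ 2 by ring.
  have -> : 2 / 5 * L * t * n ^+ 3 = (2 / 5 * L * t * n) * n ^+ 2 by ring.
  by apply: ler_wpM2l; rewrite ?lerXn2r ?nnegrE ?mulr_ge0 //; lra.
have e2 : 8 / 5 * (L * K) * ((n - t) * (t + 2) / n ^+ 2) <= t / 2.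
  have -> : 8 / 5 * (L * K) * ((n - t) * (t + 2) / n ^+ 2) =
    8 / 5 * (L * K) * ((n - t) * (t + 2)) / n ^+ 2 by field; lra.
  rewrite ler_pdivrMr ?exprn_gt0 //.
  have : (60 * 100 * (L * K)) * ((n - t) * (t + 2)) <= (h * n) * (n * (3 * t)).
    have LK0 : 0 <= L * K by rewrite mulr_ge0 //; lra.
    have st0 : 0 <= (n - t) * (t + 2) by rewrite mulr_ge0 //; lra.
    have st : (n - t) * (t + 2) <= n * (3 * t) by apply: ler_pM; lra.
    by apply: ler_pM => //; lra.
  have : 0 <= n ^+ 2 * t by rewrite mulr_ge0 ?exprn_ge0 //; lra.
  have -> : (h * n) * (n * (3 * t)) = 3 * (h * (n ^+ 2 * t)) by ring.
  move=> nt0; have : h * (n ^+ 2 * t) <= 1 * (n ^+ 2 * t) by apply: ler_wpM2r => //; lra.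
  lra.
lra.
Qed.

(** With [u = (n - t)/n <= 1/2], [1 - (1 - u)^3 >= 7/4 u]. *)
Lemma fixfrac_exponent_many (R : realFieldType) (h K n L m N t : R) :
  large_scale h K n L m N -> 9 / 7 * (n * L - n) <= m -> n <= 2 * t -> t <= n ->
  (9 / 4 * (L - 1) - 1 / 2) * (n - t) <= m * (1 - fixfrac K n t).
Proof.
move=> ls mlo nt tn; have [L6 Ln LK N0] := ls_basic ls; have n6 := ls_n1 ls.
have t0 : 0 <= t by lra.
have := @fixfrac_error_le R h K n L m N (n - t) t ls.
rewrite subr_ge0 => /(_ tn t0) err.
case: ls => h0 h1 K1 _ _ m1 mL _.
have n0 : 0 < n by lra.
rewrite /fixfrac mulrDl.
have main : 9 / 4 * (L - 1) * (n - t) <= m * (1 - t ^+ 3 / n ^+ 3).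
  have -> : m * (1 - t ^+ 3 / n ^+ 3) = m * (n ^+ 3 - t ^+ 3) / n ^+ 3 by field; lra.
  rewrite ler_pdivlMr ?exprn_gt0 //.
  have cube : 7 / 4 * ((n - t) * n ^+ 2) <= n ^+ 3 - t ^+ 3.
    have -> : n ^+ 3 - t ^+ 3 = (n - t) * (n ^+ 2 + n * t + t ^+ 2) by ring.
    have : (n - t) * (7 / 4 * n ^+ 2) <= (n - t) * (n ^+ 2 + n * t + t ^+ 2).
      by apply: ler_wpM2l; [lra | nra].
    lra.
  apply: le_trans (_ : 9 / 7 * (n * L - n) * (7 / 4 * ((n - t) * n ^+ 2)) <= _).
    lra.
  apply: ler_pM => //; rewrite ?mulr_ge0 ?exprn_ge0 //; try lra.
  have : n * 1 <= n * L by apply: ler_wpM2l; lra.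
  lra.
have e2 : 8 / 5 * (L * K) * ((n - t) * (t + 2) / n ^+ 2) <= (n - t) / 2.
  have -> : 8 / 5 * (L * K) * ((n - t) * (t + 2) / n ^+ 2) =
    8 / 5 * (L * K) * ((n - t) * (t + 2)) / n ^+ 2 by field; lra.
  rewrite ler_pdivrMr ?exprn_gt0 //.
  have : (60 * 100 * (L * K)) * ((n - t) * (t + 2)) <= (h * n) * ((n - t) * (2 * n)).
    have LK0 : 0 <= L * K by rewrite mulr_ge0 //; lra.
    have st0 : 0 <= (n - t) * (t + 2) by rewrite mulr_ge0 //; lra.
    have st : (n - t) * (t + 2) <= (n - t) * (2 * n) by apply: ler_pM; lra.
    by apply: ler_pM => //; lra.
  have : 0 <= n ^+ 2 * (n - t) by rewrite mulr_ge0 ?exprn_ge0 //; lra.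
  have -> : (h * n) * ((n - t) * (2 * n)) = 2 * (h * (n ^+ 2 * (n - t))) by ring.
  move=> nt0; have : h * (n ^+ 2 * (n - t)) <= 1 * (n ^+ 2 * (n - t)) by apply: ler_wpM2r => //; lra.
  lra.
lra.
Qed.

From mathcomp Require Import all_classical all_reals all_analysis.

(** * The factorial and powers of two *)

(** The two bounds [5/8 <= ln 2 <= 7/9] turn [2^m ~ n!] into bounds on [m]; they
    are sharp enough for the ranges of [t] to be settled as described above. *)
Lemma expR_five_eighths (R : realType) : expR (5 / 8) <= 2 :> R.
Proof.
(* fourth power of [1 - x <= exp (- x)] at [x = 5/32]; [(27/32)^4 > 1/2] *)
have h : 27 / 32 <= expR (- (5 / 32)) :> R.
  by apply: le_trans (expR_ge1Dx _); lra.
have h4 : (27 / 32) ^+ 4 <= expR (- (5 / 32)) ^+ 4 :> R.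
  by rewrite lerXn2r // nnegrE ?expR_ge0 //; lra.
rewrite -expRM_natl (_ : 4%:R * - (5 / 32) = - (5 / 8)) in h4; last by field.
have e0 := expR_gt0 (5 / 8 : R); have := expRxMexpNx_1 (5 / 8 : R).
nra.
Qed.

Lemma expR_seven_ninths (R : realType) : 2 <= expR (7 / 9) :> R.
Proof.
have h : 43 / 36 <= expR (7 / 36) :> R by apply: le_trans (expR_ge1Dx _); lra.
have h4 : (43 / 36) ^+ 4 <= expR (7 / 36) ^+ 4 :> R.
  by rewrite lerXn2r // nnegrE ?expR_ge0 //; lra.
rewrite -expRM_natl (_ : 4%:R * (7 / 36) = 7 / 9) in h4; last by field.
nra.
Qed.

(** The step multiplies the left-hand side by [(n+1) (1 + 1/n)^n], which is at
    most [(n+1) e]. *)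
Lemma expn_le_fact (R : realType) (n : nat) :
  n%:R ^+ n <= expR n%:R * (n`!)%:R :> R.
Proof.
elim: n => [|n IH]; first by rewrite expr0 expR0 fact0 mulr1.
case: n IH => [|n] IH.
  rewrite expr1 (_ : 1`! = 1%N) // mulr1; apply: le_trans (expR_ge1Dx _); lra.
set N := n.+1 in IH *; have N0 : 0 < N%:R :> R by [].
have step : N.+1%:R ^+ N <= expR 1 * N%:R ^+ N :> R.
  have -> : expR 1 = expR (N%:R^-1) ^+ N :> R.
    by rewrite -expRM_natl mulfV // lt0r_neq0.
  rewrite -exprMn lerXn2r // ?nnegrE ?mulr_ge0 ?expR_ge0 //.
  rewrite -ler_pdivrMr // -natr1 mulrDl mulfV ?lt0r_neq0 // mul1r.
  exact: expR_ge1Dx.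
rewrite exprS factS natrM -[in expR _]natr1 expRD.
rewrite [_ * (N.+1%:R * _)]mulrCA ler_wpM2l //.
rewrite [expR _ * expR 1]mulrC -mulrA (le_trans step) // ler_wpM2l ?expR_ge0 //.
Qed.

Lemma three_fact_le (n : nat) : (3 <= n)%N -> (3 * n`! <= n ^ n)%N.
Proof.
move=> n3; rewrite -(subnK n3); elim: (n - 3)%N => [//|j IH].
rewrite addSn factS expnS mulnCA leq_mul2l /= (leq_trans IH) //.
by rewrite leq_exp2r // ?addnS.
Qed.

Lemma fact_le_expn (n t : nat) : (t <= n)%N -> (n`! <= t`! * n ^ (n - t))%N.
Proof.
move=> tn; rewrite -(ffact_fact (leq_subr t n)) subKn // mulnC leq_mul2l.
apply/orP; right; elim: (n - t)%N => [//|j IH].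
by rewrite ffactnSr expnSr leq_mul // leq_subr.
Qed.

(** This makes every power of [L] that occurs negligible against [n]. *)
Lemma ln_pow4_le (R : realType) (L : R) : 0 <= L -> L ^+ 4 <= 16 * 16 * expR L.
Proof.
move=> L0; have -> : expR L = expR (L / 4) ^+ 4.
  by rewrite -expRM_natl; congr expR; field.
have h : L / 4 <= expR (L / 4) by apply: le_trans (expR_ge1Dx _); lra.
have : (L / 4) ^+ 4 <= expR (L / 4) ^+ 4.
  by rewrite lerXn2r // nnegrE ?expR_ge0 //; lra.
by rewrite expr_div_n; lra.
Qed.

Lemma trunc_log_fact_bounds (R : realType) (n : nat) : (3 <= n)%N ->
  let m := trunc_log 2 (3 * n`!) in let L := ln n%:R : R in
  [/\ 2 ^+ m <= 3 * (n`!)%:R :> R, 3 * (n`!)%:R < 2 * 2 ^+ m :> R,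
      m%:R <= 8 / 5 * (n%:R * L) & 9 / 7 * (n%:R * L - n%:R) <= m%:R].
Proof.
move=> n3 m L.
have npos : 0 < n%:R :> R by rewrite ltr0n (leq_trans _ n3).
have nL : expR (n%:R * L) = n%:R ^+ n by rewrite expRM_natl lnK.
have f0 : (0 < 3 * n`!)%N by rewrite muln_gt0 fact_gt0.
have up : 2 ^+ m <= 3 * (n`!)%:R :> R.
  by rewrite -natrX -natrM ler_nat trunc_logP.
have lo : 3 * (n`!)%:R < 2 * 2 ^+ m :> R.
  by rewrite -exprS -natrX -natrM ltr_nat trunc_log_ltn.
split=> //.
  suff : expR (m%:R * (5 / 8)) <= expR (n%:R * L) by rewrite ler_expR; lra.
  rewrite nL expRM_natl.
  have h5 : expR (5 / 8) ^+ m <= 2 ^+ m :> R.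
    by rewrite lerXn2r // ?nnegrE ?expR_ge0 // expR_five_eighths.
  apply: (le_trans h5); apply: (le_trans up).
  by rewrite -natrX -natrM ler_nat three_fact_le.
suff : expR (n%:R * L - n%:R) <= expR (m%:R * (7 / 9)) by rewrite ler_expR; lra.
rewrite expRB nL ler_pdivrMr ?expR_gt0 // expRM_natl.
apply: (le_trans (expn_le_fact R n)); rewrite mulrC ler_wpM2r ?expR_ge0 //.
have h7 : 2 ^+ m <= expR (7 / 9) ^+ m :> R.
  by rewrite lerXn2r // ?nnegrE ?expR_ge0 // expR_seven_ninths.
apply: le_trans h7; have : 0 <= (n`!)%:R :> R by []; lra.
Qed.

(** * Powers of the growth factor *)

Lemma large_scale_eventually (R : realType) (k : nat) (h : R) :
  (3 <= k)%N -> 0 < h -> h <= 1 / 4 ->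
  exists n0 : nat, forall n : nat, (n0 <= n)%N ->
    [/\ (3 <= n)%N, (k <= n)%N &
     large_scale h (k ^ 4)%:R n%:R (ln n%:R) (trunc_log 2 (3 * n`!))%:R 'C(n, k)%:R].
Proof.
move=> k3 h0 h1; pose A : R := 60 * 100 * (k ^ 4)%:R / h.
exists ((Num.trunc (expR A)).+1 + k)%N => n n0n.
have kn : (k <= n)%N by rewrite (leq_trans _ n0n) // leq_addl.
have n3 := leq_trans k3 kn; split=> //.
have npos : 0 < n%:R :> R by rewrite ltr0n (leq_trans _ n3).
have [_ _ mle _] := trunc_log_fact_bounds R n3.
have AL : A <= ln n%:R.
  rewrite -[A]expRK ler_ln ?posrE ?expR_gt0 //.
  apply: ltW; apply: lt_le_trans (truncnS_gt _) _.
  by rewrite ler_nat (leq_trans _ n0n) // leq_addr.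
have K1 : 1 <= (k ^ 4)%:R :> R by rewrite ler1n expn_gt0 (leq_trans _ k3).
have A0 : 0 <= A by rewrite /A !mulr_ge0 ?invr_ge0 ?ltW //; lra.
split=> //.
- by move: AL; rewrite /A ler_pdivrMr // [_ * h]mulrC.
- by have := ln_pow4_le (le_trans A0 AL); rewrite [expR _]lnK ?posrE.
- by rewrite ler1n trunc_log_gt0 /=; apply: (@leq_trans (3 * 1)%N) => //; rewrite leq_mul2l fact_gt0.
- rewrite -natrX -natrM ler_nat.
  have := bin_sub_ratio k3 kn; have : (0 < 'C(n - 3, k - 3))%N by rewrite bin_gt0 leq_sub2r.
  have : (k ^ 3 <= k ^ 4)%N by rewrite leq_pexp2l // (leq_trans _ k3).
  move: (k ^ 3)%N (k ^ 4)%N (n ^ 3)%N 'C(n, k) 'C(n - 3, k - 3) => a b c d e; nia.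
Qed.

Section Tilt.
Variables (R : realType) (h K N : R) (n t m : nat).
Let L : R := ln n%:R.
Let q : R := expR (4 - L / 10).
Let r : R := (N + N * fixfrac K n%:R t%:R + 3 * m%:R) / (N - m%:R).
Hypothesis n3 : (3 <= n)%N.
Hypothesis ls : large_scale h K n%:R L m%:R N.
Hypothesis tn : (t < n)%N.

Let delta : R := 8 * m%:R / N.

Lemma ls_8m : 8 * m%:R <= N.
Proof.
have md := tilt_correction_le ls; have [_ _ _ N0] := ls_basic ls.
case: (ls) => h0 h1 _ _ _ m1 _ _.
move: md; rewrite mulrA ler_pdivrMr // => md.
by nra.
Qed.

Lemma tilt_base : r <= 1 + fixfrac K n%:R t%:R + delta.
Proof.
have [_ _ _ N0] := ls_basic ls.
apply: tilt_base_le => //; first exact: ls_8m.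
by apply: (fixfrac_le2 ls); rewrite ler0n ler_nat ltnW.
Qed.

Lemma fixfrac_ge0 : 0 <= fixfrac K n%:R t%:R.
Proof.
case: (ls) => _ _ K1 _ _ _ _ _.
apply: divr_ge0; last by rewrite exprn_ge0.
apply: addr_ge0; first by rewrite exprn_ge0.
by apply: mulr_ge0; [apply: mulr_ge0; rewrite ?subr_ge0 ?ler_nat 1?ltnW ?addr_ge0|lra].
Qed.

Lemma tilt_ge0 : 0 <= r.
Proof.
have [_ _ _ N0] := ls_basic ls; have m8 := ls_8m; have f0 := fixfrac_ge0.
have m0 : 0 <= m%:R :> R by [].
have Nf : 0 <= N * fixfrac K n%:R t%:R by rewrite mulr_ge0 // ltW.
by apply: divr_ge0; lra.
Qed.

Lemma tilt_exp : r ^+ m <= expR (m%:R * fixfrac K n%:R t%:R + h).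
Proof.
have rb := tilt_base; have r0 := tilt_ge0; have md := tilt_correction_le ls.
apply: le_trans (_ : expR (fixfrac K n%:R t%:R + delta) ^+ m <= _).
  rewrite lerXn2r // ?nnegrE ?expR_ge0 //; apply: (le_trans rb).
  by apply: le_trans (expR_ge1Dx _); rewrite addrA.
by rewrite -expRM_natl ler_expR mulrDr lerD2l.
Qed.

(** Case of few fixed points: the term of [s] is [1 + o(1)]. *)
Lemma tilt_few : (t ^ 2 <= n)%N -> r ^+ m <= 1 + 4 * h.
Proof.
move=> t2; case: (ls) => h0 h1 _ _ _ _ _ _.
have mf : m%:R * fixfrac K n%:R t%:R <= h.
  by apply: (fixfrac_exponent_few ls) => //; rewrite -natrX ler_nat.
apply: (le_trans tilt_exp); apply: le_trans (_ : expR (2 * h) <= _).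
  by rewrite ler_expR; lra.
have e1 := expR_ge1Dx (- (2 * h)); have e2 := expRxMexpNx_1 (2 * h).
have e0 := expR_gt0 (2 * h).
have : expR (2 * h) * (1 - 2 * h) <= 1.
  by rewrite -[leRHS]e2; apply: ler_wpM2l; [exact: ltW | lra].
nra.
Qed.

(** [t! >= (t/e)^t >= exp (t L / 2 - t)] since [t >= exp (L / 2)]. *)
Lemma tilt_mid : (n < t ^ 2)%N -> (2 * t <= n)%N -> r ^+ m <= (t`!)%:R * q ^+ t.
Proof.
move=> t2 tn2; case: (ls) => h0 h1 _ _ _ _ _ _.
have t0 : (0 < t)%N by case: (t) t2.
have t1 : 1 <= t%:R :> R by rewrite ler1n.
have mf : m%:R * fixfrac K n%:R t%:R <= (2 / 5 * L + 1 / 2) * t%:R.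
  by apply: (fixfrac_exponent_mid ls) => //; rewrite -natrM ler_nat.
have npos : 0 < n%:R :> R by rewrite ltr0n (leq_trans _ n3).
have tL : expR (L / 2) <= t%:R.
  have : expR (L / 2) ^+ 2 <= t%:R ^+ 2.
    rewrite -expRM_natl (_ : 2%:R * (L / 2) = L); last by field.
    by rewrite lnK ?posrE // -natrX ler_nat ltnW.
  by rewrite ler_pXn2r // nnegrE ?expR_ge0.
have tt : expR (L / 2) ^+ t <= expR t%:R * (t`!)%:R.
  by apply: le_trans (expn_le_fact R t); rewrite lerXn2r // ?nnegrE ?expR_ge0.
rewrite -expRM_natl in tt.
have ft : expR (t%:R * (L / 2) - t%:R) <= (t`!)%:R.
  by rewrite expRB ler_pdivrMr ?expR_gt0 // [leRHS]mulrC.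
apply: (le_trans tilt_exp).
apply: le_trans (ler_wpM2r _ ft); last by rewrite exprn_ge0 ?expR_ge0.
rewrite /q -expRM_natl -expRD ler_expR; nra.
Qed.

(** Here the growth factor is near 2, so it is compared with [2 exp (- y)], where
    [y] is half its distance from 2.  The power [2^m] is of the order of [n!],
    the gain [m y] is at least [(9/8) L (n - t) - O(n - t)], and it beats
    [n!/t! <= exp (L (n - t))]. *)
Lemma tilt_most : 2 ^+ m <= 3 * (n`!)%:R :> R ->
  9 / 7 * (n%:R * L - n%:R) <= m%:R -> (n <= 2 * t)%N ->
  r ^+ m <= (t`!)%:R * q ^+ (n - t).
Proof.
move=> mup mlo nt; have [L6 Ln LK N0] := ls_basic ls.
case: (ls) => h0 h1 _ _ _ m1 _ _.
have npos : 0 < n%:R :> R by rewrite ltr0n (leq_trans _ n3).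
have s1 : 1 <= (n - t)%:R :> R by rewrite ler1n subn_gt0.
have sE : (n - t)%:R = n%:R - t%:R :> R by rewrite natrB // ltnW.
have mf := @fixfrac_exponent_many R h K n%:R L m%:R N t%:R ls mlo.
have {}mf : (9 / 4 * (L - 1) - 1 / 2) * (n - t)%:R <= m%:R * (1 - fixfrac K n%:R t%:R).
  by rewrite sE; apply: mf; rewrite -?natrM ler_nat // ltnW.
have md := tilt_correction_le ls.
set y := (1 - fixfrac K n%:R t%:R - delta) / 2.
have ry : r <= 2 * expR (- y).
  apply: (le_trans tilt_base); have := expR_ge1Dx (- y); rewrite {1}/y; lra.
have rm : r ^+ m <= 2 ^+ m * expR (- (m%:R * y)).
  rewrite -mulrN expRM_natl -exprMn lerXn2r // nnegrE; first exact: tilt_ge0.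
  by rewrite mulr_ge0 ?expR_ge0.
have my : (9 / 8 * (L - 1) - 1 / 2) * (n - t)%:R <= m%:R * y.
  have : m%:R * delta <= 1 * (n - t)%:R / 2 by rewrite /delta; lra.
  rewrite /y; lra.
have nf : (n`!)%:R <= (t`!)%:R * expR ((n - t)%:R * L) :> R.
  by rewrite expRM_natl lnK ?posrE // -natrX -natrM ler_nat fact_le_expn // ltnW.
have e3 : 3 <= expR (2 * (n - t)%:R) :> R by apply: le_trans (expR_ge1Dx _); lra.
apply: (le_trans rm).
apply: le_trans (_ : (expR (2 * (n - t)%:R) * ((t`!)%:R * expR ((n - t)%:R * L)))
   * expR (- (m%:R * y)) <= _).
  rewrite ler_wpM2r ?expR_ge0 // (le_trans mup) //.
  by apply: ler_pM.
rewrite mulrCA -mulrA ler_wpM2l // -!expRD /q -expRM_natl ler_expR.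
nra.
Qed.

End Tilt.

(** * Summing over all permutations *)

Lemma geometric_tail_le (R : realFieldType) (q : R) (n : nat) :
  0 <= q -> q <= 1 / 2 -> \sum_(1 <= t < n) q ^+ t <= 2 * q.
Proof.
move=> q0 q1; case: n => [|n]; first by rewrite big_geq // mulr_ge0.
suff : \sum_(1 <= t < n.+1) q ^+ t + 2 * q ^+ n.+1 <= 2 * q.
  have : 0 <= q ^+ n.+1 by rewrite exprn_ge0.
  lra.
elim: n => [|n IH]; first by rewrite big_geq // expr1 add0r.
rewrite big_nat_recr //=; apply: le_trans IH; rewrite -addrA lerD2l.
have : 0 <= q ^+ n.+1 by rewrite exprn_ge0.
rewrite [q ^+ n.+2]exprS; nra.
Qed.

Lemma two_ended_geometric_le (R : realFieldType) (q : R) (n : nat) :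
  0 <= q -> q <= 1 / 2 -> \sum_(1 <= t < n) (q ^+ t + q ^+ (n - t)) <= 4 * q.
Proof.
move=> q0 q1; have le := geometric_tail_le n q0 q1.
have rev : \sum_(1 <= t < n) q ^+ (n - t) = \sum_(1 <= t < n) q ^+ t.
  rewrite big_nat_rev /=; apply: eq_big_nat => t /andP[t1 tn].
  by congr (q ^+ _); lia.
by rewrite big_split /= rev; lra.
Qed.

(** Grouping by the number of fixed points; a permutation other than the identity
    has fewer than [n] of them. *)
Lemma sum_perm_nfix_le (R : realFieldType) (n : nat) (T : nat -> R) :
  (forall t, 0 <= T t) ->
  \sum_(s : 'S_n | s != 1%g) (nfix s)`!%:R * T (nfix s) <= (n`!)%:R * \sum_(t < n) T t.
Proof.
move=> T0.
have T0' t : 0 <= t`!%:R * T t by rewrite mulr_ge0.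
apply: le_trans (_ : \sum_(s : 'S_n) \sum_(t < n | nfix s == t) t`!%:R * T t <= _).
  rewrite [leRHS](bigID (fun s => s != 1%g)) /= -[leLHS]addr0 lerD //.
    apply: ler_sum => s /nfix_lt; rewrite card_ord => sn.
    by rewrite (bigD1 (Ordinal sn)) //= lerDl sumr_ge0.
  by apply: sumr_ge0 => s _; apply: sumr_ge0.
under eq_bigr do rewrite big_mkcond /=.
rewrite exchange_big /= mulr_sumr ler_sum // => t _.
rewrite -big_mkcond /= sumr_const -[leLHS]mulr_natl mulrA ler_wpM2r // -natrM ler_nat.
by have := card_perm_nfix 'I_n t; rewrite card_ord cardsE.
Qed.

(** The main term is [n!] times the bound [1 + 4 h] for permutations with few
    fixed points; the others contribute at most [4 q n!] with [q <= h]. *)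
Lemma sum_tilt_le (R : realType) (k : nat) (eps : R) :
  (3 <= k)%N -> 0 < eps -> exists n0 : nat, forall n : nat, (n0 <= n)%N ->
  let m := trunc_log 2 (3 * n`!) in let X := ksets k 'I_n in
  [/\ (3 <= n)%N, (m < #|X|)%N &
  \sum_(s : 'S_n | s != 1%g)
     ((#|X|%:R + #|[set e in X | s @: (e : {set 'I_n}) == e]|%:R + 3 * m%:R)
        / (#|X|%:R - m%:R)) ^+ m <= (1 + eps) * (n`!)%:R].
Proof.
move=> k3 eps0; pose h : R := Num.min (eps / 8) (1 / 4).
have h0 : 0 < h by rewrite lt_min; apply/andP; split; lra.
have h1 : h <= 1 / 4 by rewrite ge_min lexx orbT.
have h2 : 8 * h <= eps.
  by have : h <= eps / 8 by [rewrite ge_min lexx]; lra.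
have [n0 big] := large_scale_eventually k3 h0 h1.
exists n0 => n /big[n3 kn ls] m X.
have cX : #|X| = 'C(n, k) by rewrite card_ksets card_ord.
rewrite -/m in ls.
have [L6 Ln LK N0] := ls_basic ls.
have m8 := ls_8m ls.
have mX : (m < 'C(n, k))%N.
  by rewrite -(ltr_nat R); case: (ls) => _ _ _ _ _ m1 _ _; lra.
rewrite cX; split=> //.
have [mup _ _ mlo] := trunc_log_fact_bounds R n3; rewrite -/m in mup mlo.
set L : R := ln n%:R in ls L6 Ln LK mlo *.
pose q : R := expR (4 - L / 10).
have q0 : 0 <= q by rewrite expR_ge0.
have qh : q <= h.
  case: (ls) => _ _ K1 hL _ _ _ _.
  have e1 := expR_ge1Dx (- (4 - L / 10)); have e2 := expRxMexpNx_1 (4 - L / 10).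
  rewrite -/q in e2; set z := expR (- _) in e1 e2.
  have hz : 1 <= h * z.
    apply: le_trans (_ : h * (1 + - (4 - L / 10)) <= _); first nra.
    by apply: ler_wpM2l; first exact: ltW.
  have : q * 1 <= q * (h * z) by rewrite ler_wpM2l.
  by rewrite mulrCA e2; lra.
(* t = 0 belongs to the range of few fixed points *)
pose T t : R := if t == 0%N then 0 else q ^+ t + q ^+ (n - t).
have T0 t : 0 <= T t by rewrite /T; case: eqP => // _; rewrite addr_ge0 ?exprn_ge0.
apply: le_trans (_ : \sum_(s : 'S_n | s != 1%g)
   ((1 + 4 * h) + (nfix s)`!%:R * T (nfix s)) <= _).
  apply: ler_sum => s s1; have := nfix_lt s1; rewrite card_ord => sn.
  set t := nfix s in sn *.
  pose r : R := ('C(n, k)%:R + 'C(n, k)%:R * fixfrac (k ^ 4)%:R n%:R t%:R + 3 * m%:R)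
     / ('C(n, k)%:R - m%:R).
  have Nm : 0 < 'C(n, k)%:R - m%:R :> R by rewrite subr_gt0 ltr_nat.
  apply: le_trans (_ : r ^+ m <= _).
    have lhs0 : 0 <= ('C(n, k)%:R + #|[set e in X | s @: (e : {set 'I_n}) == e]|%:R + 3 * m%:R)
        / ('C(n, k)%:R - m%:R) :> R.
      by apply: divr_ge0; [rewrite !addr_ge0 ?mulr_ge0|exact: ltW].
    rewrite lerXn2r // ?nnegrE //; first exact: (tilt_ge0 ls sn).
    rewrite /r ler_pM2r ?invr_gt0 // lerD2r lerD2l.
    have := card_invariant_ksets (T := 'I_n) s k3; rewrite card_ord => /(_ kn).
    rewrite /fixfrac mulrA ler_pdivlMr ?exprn_gt0 ?ltr0n ?(leq_trans _ n3) // => inv.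
    rewrite -natrB; last exact: ltnW.
    rewrite -!natrX -!natrM -[2]/(2%:R) -!natrD -!natrM -!natrD -natrM ler_nat.
    exact: inv.
  have [t2|t2] := leqP (t ^ 2) n.
    by apply: (le_trans (tilt_few ls sn t2)); rewrite lerDl mulr_ge0.
  have t0 : (t == 0%N) = false by apply/negbTE; case: (t) t2.
  apply: le_trans (_ : t`!%:R * T t <= _); last by rewrite lerDr; lra.
  rewrite /T t0 mulrDr.
  have [nt|nt] := leqP (2 * t) n.
    apply: (le_trans (tilt_mid n3 ls sn t2 nt)).
    by rewrite lerDl mulr_ge0 ?exprn_ge0.
  apply: (le_trans (tilt_most n3 ls sn mup mlo (ltnW nt))).
  by rewrite lerDr mulr_ge0 ?exprn_ge0.
rewrite big_split /=.
have tail : \sum_(t < n) T t <= 4 * q.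
  rewrite -(big_mkord xpredT T) big_ltn ?(leq_trans _ n3) // {1}/T eqxx add0r.
  have -> : \sum_(1 <= t < n) T t = \sum_(1 <= t < n) (q ^+ t + q ^+ (n - t)).
    by apply: eq_big_nat => t /andP[t1 _]; rewrite /T; case: (t) t1.
  by apply: two_ended_geometric_le => //; lra.
apply: le_trans (_ : (n`!)%:R * (1 + 4 * h) + (n`!)%:R * (4 * q) <= _).
  rewrite lerD //.
    rewrite sumr_const -[leLHS]mulr_natl ler_wpM2r //; first by lra.
    by rewrite ler_nat -card_Sn max_card.
  by apply: (le_trans (sum_perm_nfix_le n T0)); rewrite ler_wpM2l.
rewrite -mulrDr mulrC ler_wpM2r //; lra.
Qed.

(** * The limit inferior *)

Lemma f_max_ge (R : realType) (k n : nat) (H : kgraph k 'I_n) :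
  #|vertices H| = n -> f_graph R H <= f_max R k n.
Proof.
by move=> Hn; rewrite /f_max; apply: le_bigmax_cond; rewrite Hn.
Qed.

(** With [l = n!/2^m] the bound on [F] gives [f(H) >= l - (1 + eps) l^2], and
    [l - l^2 - 2/9 = (l - 1/3) (2/3 - l) >= 0]. *)
Lemma f_max_eventually (R : realType) (k : nat) (eps : R) :
  (3 <= k)%N -> 0 < eps -> exists n0 : nat, forall n : nat, (n0 <= n)%N ->
  2 / 9 - eps <= f_max R k n.
Proof.
move=> k3 eps0; have [n0 big] := sum_tilt_le k3 eps0.
exists n0 => n /big[]; set m := trunc_log _ _; set X := ksets _ _ => n3 mX bound.
pose g (s : 'S_n) (e : {set 'I_n}) := s @: e.
have gI s : injective (g s) by apply: imset_inj; apply: perm_inj.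
have [F [FX Fm small]] := exists_small_selfmeet R (fun s => s != 1%g) gI mX.
have {small bound} S := le_trans small bound.
have [H [HV count]] := num_unique_lower FX.
have Hn : #|vertices H| = n by rewrite HV cardsT card_ord.
apply: le_trans (f_max_ge R Hn); rewrite /f_graph Hn.
have [mup mlo _ _] := trunc_log_fact_bounds R n3; rewrite -/m in mup mlo.
move: count; rewrite Fm card_ord -(ler_nat R) natrD !natrM !natrX natr_sum mulnC exprM.
under eq_bigr do rewrite natrX.
set U : R := (num_unique H)%:R; set Q : R := 2 ^+ 'C(n, k); set P : R := 2 ^+ m.
set f : R := (n`!)%:R; set Sg : R := \sum_(s | _) _ => count.
have {}S : Sg <= (1 + eps) * f by [].
have Q0 : 0 < Q by rewrite exprn_gt0.
have P0 : 0 < P by rewrite exprn_gt0.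
have f0 : 0 < f by rewrite ltr0n fact_gt0.
rewrite invf_div mulrA ler_pdivlMr //.
have lower : Q * (P - (1 + eps) * f) <= U * P ^+ 2.
  have : Q * Sg <= Q * ((1 + eps) * f) by rewrite ler_wpM2l // ltW.
  lra.
have P2 : 0 < P ^+ 2 by rewrite exprn_gt0.
rewrite -(ler_pM2r P2).
have : Q * (P - (1 + eps) * f) * f <= U * P ^+ 2 * f by rewrite ler_wpM2r // ltW.
suff : (2 / 9 - eps) * P ^+ 2 <= (P - (1 + eps) * f) * f.
  move=> h1 h2.
  have : Q * ((2 / 9 - eps) * P ^+ 2) <= Q * ((P - (1 + eps) * f) * f).
    by rewrite ler_wpM2l // ltW.
  lra.
have {}mup : P <= 3 * f by []; have {}mlo : 3 * f < 2 * P by [].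
have quad : 0 <= (3 * f - P) * (2 * P - 3 * f) by rewrite mulr_ge0 // subr_ge0 // ltW.
have fP : f ^+ 2 <= P ^+ 2 by rewrite lerXn2r // ?nnegrE; lra.
have : eps * f ^+ 2 <= eps * P ^+ 2 by rewrite ler_wpM2l // ltW.
lra.
Qed.

Theorem theorem1p2 (R : realType) (k : nat) (hk : (3 <= k)%N) :
  ((2 / 9 : R)%:E <= limn_einf (fun n : nat => (f_max R k n)%:E))%E.
Proof.
apply/lee_addgt0Pr => eps eps0.
have [n0 le] := f_max_eventually hk eps0.
set u := fun n : nat => (f_max R k n)%:E.
rewrite -leeBlDr // limn_einf_lim (cvg_lim _ (@cvg_einfs_sup _ u)) //.
apply: le_trans (_ : einfs u n0 <= _)%E; last first.
  by apply: ereal_sup_ubound; exists n0.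
apply: le_ereal_inf_tmp => _ [n /= n0n <-].
by rewrite -EFinB lee_fin le.
Qed.
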